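(* Let $f_{\mathcal{X}}:\mathcal{X}\to\mathbb{R}^d$, $f_{\mathcal{Y}}:\mathcal{Y}\to\mathbb{R}^d$, $\tau>0$ and $g(x,y)=f_{\mathcal{X}}(x)^\top f_{\mathcal{Y}}(y)/\tau$. Let $g^*(x,y)=\ln\frac{p(x,y)}{p(x)p(y)}+\Gamma$ for some constant $\Gamma\in\mathbb{R}$. Assume there exist $K$ pairwise disjoint measurable subsets $\mathcal{Y}_1,\dots,\mathcal{Y}_K\subseteq\mathcal{Y}$ with $P_Y(\mathcal{Y}_i)>0$ and constants $\epsilon_1,\epsilon_2\ge0$ such that, for all $x\in\operatorname{supp}p_X$ and all $c\in[K]$, $$\mathrm{KL}\big(P_C(\cdot\mid x)\,\big\|\,P_C(\cdot\mid x;(\mathcal{Y}_i)_{i\in[K]})\big)\le\epsilon_1,\qquad \mathrm{KL}\big(p_Y(\cdot\mid\mathcal{Y}_c)\,\big\|\,p_Y(\cdot\mid x,\mathcal{Y}_c)\big)\le\epsilon_2.$$ Assume further there is $\Delta\ge0$ with $|g(x,y)-g^*(x,y)|\le\Delta$ for all $x\in\operatorname{supp}p_X$, $y\in\operatorname{supp}p_Y$. Then $$\inf_{W\in\mathbb{R}^{d\times K},\,b\in\mathbb{R}^K}\mathcal{L}_{\sup}\big(W^\top f_{\mathcal{X}}(\cdot)+b\big)-\mathcal{L}_{\sup}(h^* )\le\epsilon_1+\epsilon_2+2\Delta.$$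
   Context: $(X,Y)$ has joint density $p(x,y)$ on $\mathcal{X}\times\mathcal{Y}$ with marginal densities $p(x)=p_X(x)$, $p(y)=p_Y(y)$ and conditional density $p(y\mid x)$; $P_Y(\mathcal{Y}')=\int_{\mathcal{Y}'}p(y)dy$, $P_Y(\mathcal{Y}'\mid x)=\int_{\mathcal{Y}'}p(y\mid x)dy$; $\tilde{\mathcal{Y}}=\bigcup_i\mathcal{Y}_i$. Labels $C\in[K]=\{1,\dots,K\}$ with $P_C(c\mid x)$, $p(x,c)=P_C(c\mid x)p_X(x)$. $\mathcal{L}_{\sup}(h)=\mathbb{E}_{(x,c)\sim p(x,c)}\big[-\ln\frac{\exp h(x)_c}{\sum_{i=1}^K\exp h(x)_i}\big]$ for $h:\mathcal{X}\to\mathbb{R}^K$, and $h^*$ is a minimizer of $\mathcal{L}_{\sup}$ over all measurable $h$ (e.g. $h^*(x)_i=\ln P_C(i\mid x)$). $p_Y(y\mid\mathcal{Y}_i)=p(y)/P_Y(\mathcal{Y}_i)$ on $\mathcal{Y}_i$ and $0$ elsewhere; $p_Y(y\mid x,\mathcal{Y}_i)=p(y\mid x)/P_Y(\mathcal{Y}_i\mid x)$ on $\mathcal{Y}_i$ and $0$ elsewhere; $P_C(c\mid x;(\mathcal{Y}_i)_{i\in[K]})=P_Y(\mathcal{Y}_c\mid x)/P_Y(\tilde{\mathcal{Y}}\mid x)$. All expectations and KL divergences are assumed well defined. *)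

(* Defs.v *)
From HB Require Import structures.
From mathcomp Require Import all_boot all_order all_algebra.
From mathcomp Require Import all_classical all_reals all_analysis.
Set Implicit Arguments. Unset Strict Implicit. Unset Printing Implicit Defensive.
Import Order.TTheory GRing.Theory Num.Theory.
Local Open Scope ring_scope.
Local Open Scope classical_set_scope.

Section Defs.
Context {R : realType}.

Definition klterm (p q : R) : \bar R :=
  if p == 0 then 0%E else if q == 0 then +oo%E else (p * ln (p / q))%:E.

Definition kl_discrete (K : nat) (P Q : 'I_K -> R) : \bar R :=
  (\sum_(c < K) klterm (P c) (Q c))%E.

Definition kl_dens d (T : measurableType d) (mu : {measure set T -> \bar R})
  (f g : T -> R) : \bar R :=
  (\int[mu]_t klterm (f t) (g t))%E.

Variables (dX dY : measure_display) (X : measurableType dX) (Y : measurableType dY).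

Definition PY (muY : {measure set Y -> \bar R}) (pY : Y -> R) (A : set Y) : R :=
  fine (\int[muY]_(y in A) (pY y)%:E)%E.

Definition condY (pXY : X -> Y -> R) (pX : X -> R) (x : X) (y : Y) : R :=
  pXY x y / pX x.

Definition PY_cond (muY : {measure set Y -> \bar R}) (pXY : X -> Y -> R)
  (pX : X -> R) (A : set Y) (x : X) : R :=
  fine (\int[muY]_(y in A) (condY pXY pX x y)%:E)%E.

Definition PC_Y (muY : {measure set Y -> \bar R}) (pXY : X -> Y -> R)
  (pX : X -> R) (K : nat) (Ys : 'I_K -> set Y) (x : X) (c : 'I_K) : R :=
  PY_cond muY pXY pX (Ys c) x / PY_cond muY pXY pX (\bigcup_(i in [set: 'I_K]) Ys i) x.

Definition dens_Yset (muY : {measure set Y -> \bar R}) (pY : Y -> R)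
  (A : set Y) (y : Y) : R :=
  if `[< A y >] then pY y / PY muY pY A else 0.

Definition dens_xYset (muY : {measure set Y -> \bar R}) (pXY : X -> Y -> R)
  (pX : X -> R) (x : X) (A : set Y) (y : Y) : R :=
  if `[< A y >] then condY pXY pX x y / PY_cond muY pXY pX A x else 0.

(* L_sup(h) = E_{(x,c) ~ p(x,c)} [ - ln softmax(h(x))_c ],
   with p(x,c) = P_C(c|x) p_X(x). *)
Definition Lsup (muX : {measure set X -> \bar R}) (pX : X -> R) (K : nat)
  (PC : X -> 'I_K -> R) (h : X -> 'I_K -> R) : \bar R :=
  (\int[muX]_x (pX x * \sum_(c < K) PC x c *
       - ln (expR (h x c) / \sum_(i < K) expR (h x i)))%:E)%E.

Definition Lsup_star (muX : {measure set X -> \bar R}) (pX : X -> R) (K : nat)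
  (PC : X -> 'I_K -> R) : \bar R :=
  ereal_inf ((fun h => Lsup muX pX PC h) @`
    [set h : X -> 'I_K -> R | forall c, measurable_fun setT (fun x => h x c)]).

Definition linprobe (d K : nat) (fX : X -> 'rV[R]_d) (W : 'M[R]_(d, K))
  (b : 'rV[R]_K) : X -> 'I_K -> R :=
  fun x c => (fX x *m W + b) 0 c.

Definition gcrit (d : nat) (fX : X -> 'rV[R]_d) (fY : Y -> 'rV[R]_d) (tau : R)
  (x : X) (y : Y) : R :=
  (fX x *m (fY y)^T) 0 0 / tau.

Definition gstar (pXY : X -> Y -> R) (pX : X -> R) (pY : Y -> R) (Gamma : R)
  (x : X) (y : Y) : R :=
  ln (pXY x y / (pX x * pY y)) + Gamma.

End Defs.

(* Main.v *)
(** The linear probe is the class-mean probe: up to the temperature, the column of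
    [W] attached to [c] is the mean of [fY] under [p_Y(. | Y_c)], and
    [b_c = ln P_Y(Y_c)].  Its score at [x] is then the mean of the critic, which is
    within [Delta] of [Gamma - KL_c(x) + ln P_Y(Y_c | x)] with [0 <= KL_c(x) <= eps2].
    Hence the log-softmax of the probe is within [eps2 + 2 * Delta] of
    [ln P_C(c | x; (Y_i))] from below; averaging over [c] costs [eps1] more than the
    entropy of [P_C(. | x)], and this entropy bounds every softmax loss from below.

    The encoder [fY] need not be integrable on [Y_c].  The KL bound only makes
    [<fX x, fY>] integrable for [x] in the support, so the mean of [fY] is replaced by
    a vector representing the linear form [v |-> E <v, fY>] on the subspace of those
    [v] for which it is defined. *)
Require Import Defs.
From HB Require Import structures.
From mathcomp Require Import all_boot all_order all_algebra.
From mathcomp Require Import all_classical all_reals all_analysis.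
From mathcomp Require Import measurable_realfun ring lra.
Import Order.TTheory GRing.Theory Num.Theory.
Local Open Scope ring_scope.
Local Open Scope classical_set_scope.

(** * Linear forms on a subspace, and a logarithm inequality *)

(** The subspace is known only as a predicate, so spanning rows have to be manufactured: a matrix
    [B] of maximal rank among those with rows in [V] has [V] inside its row space, and [pinvmx B]
    turns the values of [L] on these rows into [w]. *)
Lemma linear_functional_on_subspace_dot (F : fieldType) (d : nat)
    (V : 'rV[F]_d -> Prop) (L : 'rV[F]_d -> F) :
  V 0 -> (forall a u v, V u -> V v -> V (a *: u + v)) ->
  (forall a u v, V u -> V v -> L (a *: u + v) = a * L u + L v) ->
  exists w : 'cV[F]_d, forall v, V v -> L v = (v *m w) 0 0.
Proof.
move=> V0 VD LD.
have L0 : L 0 = 0.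
  by have := LD (-1) _ _ V0 V0; rewrite scaler0 addr0 mulN1r addNr.
have VLsum m (c : 'rV[F]_m) (B : 'M[F]_(m, d)) : (forall i, V (row i B)) ->
    V (c *m B) /\ L (c *m B) = \sum_i c 0 i * L (row i B).
  move=> VB; rewrite mulmx_sum_row.
  elim/big_rec2: _ => [//|i y1 y2 _ [Vy2 <-]].
  by split; [exact: VD | exact: LD].
pose P (n : nat) := `[< exists2 B : 'M[F]_d, forall i, V (row i B) & \rank B = n >].
have exP : exists n, P n.
  by exists 0%N; apply/asboolP; exists 0 => [i|]; rewrite ?row0 ?mxrank0.
have leP n : P n -> (n <= d)%N.
  by move=> /asboolP[B _ <-]; exact: rank_leq_row.
case: (ex_maxnP exP leP) => n /asboolP[B VB rB] maxn.
exists (pinvmx B *m \col_i L (row i B)) => v Vv.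
have vB : (v <= B)%MS.
  apply/negPn/negP => nvB.
  (* Stacking under [B] a vector outside its row space raises the rank; [<<_>>] brings the stack
     back to [d] rows, so that it competes with [B] in [P]. *)
  pose C := <<col_mx B v>>%MS.
  have VC i : V (row i C).
    have /submxP[D ->] : (row i C <= col_mx B v)%MS.
      by rewrite (submx_trans (row_sub _ _))// genmxE.
    rewrite -[D]hsubmxK mul_row_col -[lsubmx D *m B]scale1r.
    apply: VD; first exact: (VLsum _ _ _ VB).1.
    by apply: (VLsum _ _ v _).1 => j; rewrite row_id.
  have : (\rank C <= n)%N by apply: maxn; apply/asboolP; exists C.
  rewrite leqNgt => /negP; apply.
  rewrite genmxE -rB -addsmxE ltnNge; apply/negP => le.
  move/negP: nvB; apply.
  by rewrite (submx_trans (addsmxSr B v))// -(geq_leqif (mxrank_leqif_sup (addsmxSl B v))).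
rewrite -{1}(mulmxKpV vB) (VLsum _ _ _ VB).2 mulmxA !mxE.
by apply: eq_bigr => i _; rewrite !mxE.
Qed.

(** This is [ln (1 + u) <= u] at [u = q / p - 1], scaled by [p]. Both Gibbs inequalities below and
    the crude bound on the entropy come from it. *)
Lemma subr_le_mul_ln_div {R : realType} (p q : R) :
  0 <= p -> 0 < q -> p - q <= p * ln (p / q).
Proof.
rewrite le_eqVlt => /predU1P[<- q0|p0 q0].
  by rewrite mul0r sub0r oppr_le0 ltW.
have qp : 0 < q / p by rewrite divr_gt0.
rewrite -[p / q]invf_div lnV ?posrE//.
have : ln (1 + (q / p - 1)) <= q / p - 1 by apply: le_ln1Dx; rewrite ltrBDr addNr.
rewrite addrC subrK => /(ler_wpM2l (ltW p0)).
by rewrite mulrBr mulr1 mulrCA divff ?gt_eqF// mulr1 mulrN; lra.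
Qed.

(** * Densities: Gibbs inequality, normalization, supports, means of vector functions *)

Section densities.
Context d (T : measurableType d) (R : realType) (mu : {measure set T -> \bar R}).

Lemma ge0_integrable_lty (f : T -> R) :
  measurable_fun setT f -> (forall t, 0 <= f t) ->
  (\int[mu]_t (f t)%:E < +oo)%E -> mu.-integrable setT (EFin \o f).
Proof.
move=> mf f0 foo; apply/integrableP; split; first exact/measurable_EFinP.
by under eq_integral do rewrite /= ger0_norm//.
Qed.

(** The integrand is at least [p - q], whose integral is 0; this gives nonnegativity. The same
    minorant makes the negative part integrable, and the KL bound then forces the positive part to
    be integrable too. *)
Lemma gibbs_inequality (p q : T -> R) (eps : R) :
  measurable_fun setT p -> measurable_fun setT q ->
  (forall t, 0 <= p t) -> (forall t, 0 <= q t) ->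
  (\int[mu]_t (p t)%:E = 1)%E -> (\int[mu]_t (q t)%:E = 1)%E ->
  (forall t, 0 < p t -> 0 < q t) ->
  (kl_dens mu p q <= eps%:E)%E ->
  mu.-integrable setT (EFin \o (fun t => p t * (ln (p t) - ln (q t)))) /\
  0 <= \int[mu]_t (p t * (ln (p t) - ln (q t))) <= eps.
Proof.
move=> mp mq p0 q0 p1 q1 pq kl.
have ip : mu.-integrable setT (EFin \o p) by apply: ge0_integrable_lty; rewrite ?p1 ?ltry.
have iq : mu.-integrable setT (EFin \o q) by apply: ge0_integrable_lty; rewrite ?q1 ?ltry.
set k := fun t => p t * (ln (p t) - ln (q t)).
have mk : measurable_fun setT (EFin \o k).
  apply/measurable_EFinP; apply: measurable_funM => //.
  by apply: measurable_funB; exact: measurableT_comp.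
(* Since [q] is positive wherever [p] is, the infinite branch of [klterm] is never reached. *)
have klE t : klterm (p t) (q t) = (k t)%:E.
  rewrite /klterm /k; have := p0 t; rewrite le_eqVlt => /predU1P[<-|pt0].
    by rewrite eqxx mul0r.
  by rewrite !gt_eqF ?pq// ln_div ?posrE ?pq.
have pqk t : p t - q t <= k t.
  have := p0 t; rewrite /k le_eqVlt => /predU1P[<-|pt0].
    by rewrite mul0r sub0r oppr_le0.
  by rewrite -ln_div ?posrE ?pq// subr_le_mul_ln_div ?pq// ltW.
move: kl; rewrite /kl_dens (eq_integral (fun t => (k t)%:E)); last by move=> t _; exact: klE.
move=> kl.
have ik : mu.-integrable setT (EFin \o k).
  (* From [k >= p - q >= - q], the negative part is dominated by [q], of total mass 1. *)
  have kneg : (\int[mu]_t ((EFin \o k)^\- t) <= 1)%E.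
    rewrite -q1; apply: ge0_le_integral => //.
    - exact: measurable_funeneg.
    - exact/measurable_EFinP.
    - move=> t _; rewrite funenegE /= -EFin_max lee_fin ge_max q0 andbT.
      by rewrite lerNl (le_trans _ (pqk t))// lerDr.
  have kneg_fin : (\int[mu]_t ((EFin \o k)^\- t))%E \is a fin_num.
    by rewrite ge0_fin_numE ?integral_ge0// (le_lt_trans kneg) ?ltry.
  have kpos : (\int[mu]_t ((EFin \o k)^\+ t) < +oo)%E.
    move: kl; rewrite integralE => /(le_lt_trans)/(_ (ltry eps)).
    rewrite -(fineK kneg_fin).
    by move: (\int[mu]_t ((EFin \o k)^\+ t))%E (fine _) => [r| |] s; rewrite ?ltry.
  apply/integrableP; split => //.
  have -> : (\int[mu]_t `|(EFin \o k) t| =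
      \int[mu]_t ((EFin \o k)^\+ t + (EFin \o k)^\- t))%E.
    by apply: eq_integral => t _; rewrite -[LHS]/((abse \o _) t) fune_abse.
  rewrite ge0_integralD//; [|exact: measurable_funepos|exact: measurable_funeneg].
  by rewrite lte_add_pinfty// (le_lt_trans kneg) ?ltry.
split=> //; apply/andP; split.
  have -> : 0 = \int[mu]_t (p t - q t) :> R.
    by rewrite RintegralB// /Rintegral p1 q1 subrr.
  by apply: le_Rintegral => //; exact: (integrableB _ ip iq).
by rewrite -lee_fin /Rintegral fineK//; exact: integrable_fin_num.
Qed.

(** Multiplied by [p], the pointwise estimate squeezes [p * g] between two integrable functions,
    [(c - Delta) * p - k] and [(c + Delta) * p - k]. Integrability and the bound both follow; where
    [p] vanishes all three are 0. *)
Lemma integral_near_log_ratio (p q g : T -> R) (c Delta : R) :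
  measurable_fun setT p -> measurable_fun setT g ->
  (forall t, 0 <= p t) -> (\int[mu]_t (p t)%:E = 1)%E ->
  mu.-integrable setT (EFin \o (fun t => p t * (ln (p t) - ln (q t)))) ->
  (forall t, 0 < p t -> `|g t - (ln (q t) - ln (p t) + c)| <= Delta) ->
  mu.-integrable setT (EFin \o (fun t => p t * g t)) /\
  `|\int[mu]_t (p t * g t) - (c - \int[mu]_t (p t * (ln (p t) - ln (q t))))|
    <= Delta.
Proof.
move=> mp mg p0 p1 ik gD.
have ip : mu.-integrable setT (EFin \o p) by apply: ge0_integrable_lty; rewrite ?p1 ?ltry.
set k := fun t => p t * (ln (p t) - ln (q t)) in ik *.
have icp a : mu.-integrable setT (EFin \o (fun t => a * p t)) by exact: (integrableZl _ a ip).
have icpE a : \int[mu]_t (a * p t) = a by rewrite RintegralZl// /Rintegral p1 mulr1.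
have il a : mu.-integrable setT (EFin \o (fun t => a * p t - k t)) by exact: (integrableB _ (icp a) ik).
have ilE a : \int[mu]_t (a * p t - k t) = a - \int[mu]_t k t by rewrite RintegralB// icpE.
have gb t : (c - Delta) * p t - k t <= p t * g t <= (c + Delta) * p t - k t.
  rewrite /k; have := p0 t; rewrite le_eqVlt => /predU1P[<-|pt0].
    by rewrite !mulr0 !mul0r subr0 lexx.
  have := gD t pt0; rewrite ler_norml => /andP[g1 g2].
  by apply/andP; split; nra.
have ig : mu.-integrable setT (EFin \o (fun t => p t * g t)).
  apply: (@le_integrable _ _ _ _ _ measurableT _
    (EFin \o (fun t => `|(c - Delta) * p t - k t| + `|(c + Delta) * p t - k t|))).
  - by apply/measurable_EFinP; exact: measurable_funM.
  - move=> t _ /=; rewrite lee_fin; have /andP[] := gb t.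
    move: ((c - Delta) * p t - k t) ((c + Delta) * p t - k t) (p t * g t) => a b m am mb.
    rewrite [leRHS]ger0_norm ?addr_ge0// ler_norml.
    have := ler_norm b; have := normr_ge0 b; have := ler_norm (- a).
    by rewrite normrN; have := normr_ge0 a; move=> *; apply/andP; split; lra.
  - apply: (@integrableD _ _ _ _ _ measurableT (EFin \o (fun t => `|(c - Delta) * p t - k t|))
      (EFin \o (fun t => `|(c + Delta) * p t - k t|))).
      exact: (integrable_abse (il _)).
    exact: (integrable_abse (il _)).
split=> //.
have h1 : \int[mu]_t ((c - Delta) * p t - k t) <= \int[mu]_t (p t * g t).
  by apply: le_Rintegral => // t _; have /andP[] := gb t.
have h2 : \int[mu]_t (p t * g t) <= \int[mu]_t ((c + Delta) * p t - k t).
  by apply: le_Rintegral => // t _; have /andP[] := gb t.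
move: h1 h2; rewrite !ilE ler_norml /k => h1 h2.
by apply/andP; split; lra.
Qed.

Lemma normalized_density (f : T -> R) (A : set T) :
  measurable_fun setT f -> (forall t, 0 <= f t) ->
  (\int[mu]_t (f t)%:E < +oo)%E -> measurable A ->
  let Z := fine (\int[mu]_(t in A) (f t)%:E)%E in
  let p t := if `[< A t >] then f t / Z else 0 in
  0 < Z ->
  [/\ measurable_fun setT p, forall t, 0 <= p t & (\int[mu]_t (p t)%:E = 1)%E].
Proof.
move=> mf f0 foo mA Z p Z0.
have pE : p = (fun t => f t / Z * \1_A t).
  by apply/funext => t; rewrite /p indicE; case: asboolP => At;
    [rewrite mem_set// mulr1 | rewrite memNset// mulr0].
have p0 t : 0 <= p t by rewrite /p; case: ifP => // _; rewrite divr_ge0// ltW.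
split => //.
  rewrite pE; apply: measurable_funM; first exact: measurable_funM.
  exact: measurable_indic.
have -> : (\int[mu]_t (p t)%:E = \int[mu]_(t in A) (Z^-1%:E * (f t)%:E))%E.
  rewrite [RHS]integral_mkcond; apply: eq_integral => t _.
  by rewrite pE indicE /patch; case: ifP => _; rewrite ?mulr0// mulr1 mulrC EFinM.
have fA : (\int[mu]_(t in A) (f t)%:E)%E \is a fin_num.
  rewrite ge0_fin_numE; last by apply: integral_ge0 => t _; rewrite lee_fin.
  rewrite (le_lt_trans _ foo)//; apply: ge0_subset_integral => //.
  - exact/measurable_EFinP.
  - by move=> t _; rewrite lee_fin.
rewrite ge0_integralZl//.
- by rewrite -(fineK fA) -EFinM mulVf// gt_eqF.
- by apply/measurable_EFinP; exact: measurable_funTS.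
- by move=> t _; rewrite lee_fin.
- by rewrite lee_fin invr_ge0 ltW.
Qed.

(** If [g] had integral 0 over [A], it would vanish almost everywhere there, and so would [f]. This
    makes [P_Y(Y_c | x)] positive as soon as [P_Y(Y_c)] is. *)
Lemma fine_integral_gt0_support (f g : T -> R) (A : set T) : measurable A ->
  measurable_fun setT f -> measurable_fun setT g ->
  (forall t, 0 <= f t) -> (forall t, 0 <= g t) ->
  (\int[mu]_t (g t)%:E < +oo)%E ->
  (forall t, 0 < f t -> 0 < g t) ->
  0 < fine (\int[mu]_(t in A) (f t)%:E)%E ->
  0 < fine (\int[mu]_(t in A) (g t)%:E)%E.
Proof.
move=> mA mf mg f0 g0 goo fg fA0.
have gA0 : (0 <= \int[mu]_(t in A) (g t)%:E)%E by apply: integral_ge0 => t _; rewrite lee_fin.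
have gA : (\int[mu]_(t in A) (g t)%:E)%E \is a fin_num.
  rewrite ge0_fin_numE// (le_lt_trans _ goo)//; apply: ge0_subset_integral => //.
  - exact/measurable_EFinP.
  - by move=> t _; rewrite lee_fin.
rewrite lt_neqAle fine_ge0// andbT eq_sym; apply/eqP => gZ.
have mEg : measurable_fun A (EFin \o g).
  by apply/measurable_EFinP; exact: measurable_funTS.
have mEf : measurable_fun A (EFin \o f).
  by apply/measurable_EFinP; exact: measurable_funTS.
have absE (h : T -> R) : (forall t, 0 <= h t) ->
    (\int[mu]_(t in A) `|(EFin \o h) t| = \int[mu]_(t in A) (h t)%:E)%E.
  by move=> h0; apply: eq_integral => t _; rewrite /= ger0_norm.
have aeg : ae_eq mu A (EFin \o g) (cst 0%E).
  by apply/(ae_eq_integral_abs mu mA mEg); rewrite absE// -(fineK gA) gZ.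
have aef : ae_eq mu A (EFin \o f) (cst 0%E).
  apply: filterS aeg => t + At => /(_ At)/= /eqP; rewrite eqe => /eqP gt0.
  congr (_%:E); apply/eqP; rewrite eq_le f0 andbT leNgt.
  by apply/negP => /fg; rewrite gt0 ltxx.
by move: fA0; rewrite -absE// (ae_eq_integral_abs mu mA mEf).2// ltxx.
Qed.

(** The coordinates of [f] may fail to be integrable against [p] while some combinations of them
    are. Those combinations form a subspace on which the integral is linear, and [w] stands in for
    the mean vector. *)
Lemma integral_scaled_dot_repr (m : nat) (p : T -> R) (f : T -> 'rV[R]_m) :
  exists w : 'cV[R]_m, forall v : 'rV[R]_m,
    mu.-integrable setT (EFin \o (fun t => p t * (v *m (f t)^T) 0 0)) ->
    \int[mu]_t (p t * (v *m (f t)^T) 0 0) = (v *m w) 0 0.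
Proof.
have E a (u v : 'rV[R]_m) t : p t * ((a *: u + v) *m (f t)^T) 0 0 =
    a * (p t * (u *m (f t)^T) 0 0) + p t * (v *m (f t)^T) 0 0.
  by rewrite mulmxDl -scalemxAl !mxE; ring.
apply: (linear_functional_on_subspace_dot _ _
  (fun v => mu.-integrable setT (EFin \o (fun t => p t * (v *m (f t)^T) 0 0)))
  (fun v => \int[mu]_t (p t * (v *m (f t)^T) 0 0))) => [|a u v iu iv|a u v iu iv].
- have -> : (fun t => p t * ((0 : 'rV_m) *m (f t)^T) 0 0) = cst 0.
    by apply/funext => t; rewrite mul0mx mxE mulr0.
  exact: integrable0.
- have -> : (fun t => p t * ((a *: u + v) *m (f t)^T) 0 0) =
    (fun t => a * (p t * (u *m (f t)^T) 0 0) + p t * (v *m (f t)^T) 0 0).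
    by apply/funext => t.
  exact: (integrableD _ (integrableZl _ a iu) iv).
- under eq_Rintegral do rewrite E.
  by rewrite RintegralD ?RintegralZl//; exact: (integrableZl _ a iu).
Qed.

End densities.

(** * Finite distributions: softmax, entropy, cross-entropy *)

(** The numerator takes the lower bound at [c], the denominator the upper bound at every [i]. A
    shift common to [lo] and [hi] cancels, which is how [Gamma] disappears from the final
    estimate. *)
Lemma neg_ln_softmax_le {R : realType} (K : nat) (h Z : 'I_K -> R) (lo hi : R) :
  (forall i, 0 < Z i) ->
  (forall i, lo + ln (Z i) <= h i <= hi + ln (Z i)) ->
  forall c, - ln (expR (h c) / \sum_i expR (h i)) <= hi - lo - ln (Z c / \sum_i Z i).
Proof.
move=> Z0 hb c.
have sum_gt0 (F : 'I_K -> R) : (forall i, 0 < F i) -> 0 < \sum_i F i.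
  move=> F0; rewrite (bigD1 c)//= ltr_wpDr//; apply: sumr_ge0 => i _; exact: ltW.
have S0 := sum_gt0 _ (fun i => expR_gt0 (h i)); have SZ0 := sum_gt0 _ Z0.
have : ln (\sum_i expR (h i)) <= hi + ln (\sum_i Z i).
  rewrite -[leRHS]expRK ler_ln ?posrE ?expR_gt0//.
  rewrite expRD lnK ?posrE// mulr_sumr; apply: ler_sum => i _.
  by rewrite -[X in _ * X](lnK (Z0 i)) -expRD ler_expR; case/andP: (hb i).
rewrite !ln_div ?posrE ?expR_gt0// expRK.
by have /andP[] := hb c; lra.
Qed.

(** Gibbs inequality for [P] against the softmax weights, both of total mass 1. *)
Lemma entropy_le_softmax_loss {R : realType} (K : nat) (P h : 'I_K -> R) :
  (forall c, 0 <= P c) -> \sum_c P c = 1 ->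
  \sum_c P c * - ln (P c) <= \sum_c P c * - ln (expR (h c) / \sum_i expR (h i)).
Proof.
move=> P0 P1; set S := \sum_i expR (h i).
(* An empty index set contradicts total mass 1; a nonempty one makes the normalizer [S] positive. *)
case: K P h P0 P1 @S => [|K] P h P0 P1 S.
  by move: P1; rewrite big_ord0 => /eqP; rewrite eq_sym oner_eq0.
have S0 : 0 < S.
  by rewrite /S big_ord_recl ltr_wpDr ?expR_gt0//; apply: sumr_ge0 => i _; exact: expR_ge0.
have s0 c : 0 < expR (h c) / S by rewrite divr_gt0 ?expR_gt0.
rewrite -subr_ge0 -sumrB; apply: le_trans (_ : \sum_c (P c - expR (h c) / S) <= _).
  by rewrite sumrB P1 -mulr_suml divff ?gt_eqF// subrr.
apply: ler_sum => c _; have := P0 c; rewrite le_eqVlt => /predU1P[<-|Pc].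
  by rewrite !mul0r subr0 sub0r oppr_le0 ltW.
apply: le_trans (subr_le_mul_ln_div _ _ (ltW Pc) (s0 c)) _.
by rewrite [ln (P c / _)]ln_div ?posrE// -mulrBr opprK [leRHS]mulrDr mulrBr mulrN; lra.
Qed.

(** Cross-entropy is entropy plus KL divergence; positivity of [Q] keeps every [klterm] finite. *)
Lemma cross_entropy_le {R : realType} (K : nat) (P Q : 'I_K -> R) (eps : R) :
  (forall c, 0 <= P c) -> (forall c, 0 < Q c) -> (kl_discrete P Q <= eps%:E)%E ->
  \sum_c P c * - ln (Q c) <= \sum_c P c * - ln (P c) + eps.
Proof.
move=> P0 Q0; rewrite /kl_discrete.
rewrite (eq_bigr (fun c => (P c * (ln (P c) - ln (Q c)))%:E)); last first.
  move=> c _; rewrite /klterm; have := P0 c; rewrite le_eqVlt => /predU1P[<-|Pc].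
    by rewrite eqxx mul0r.
  by rewrite !gt_eqF// ln_div ?posrE.
rewrite sumEFin lee_fin => kl.
rewrite -lerBlDl -sumrB (le_trans _ kl)//; apply: ler_sum => c _.
by rewrite -mulrBr opprK addrC.
Qed.

(** * The averaged critic of one class at a fixed point [x] *)

(** Meant for [f = pXY x], [m = pX x], [p = pY] and [g] the critic at [x]. Averaging [g] under [pA]
    gives [Gamma + ln Q - ln P] minus a KL divergence in [[0, eps]], up to [Delta]; the bias [ln P]
    of the probe then leaves [ln Q]. *)
Lemma class_score_bounds d (R : realType) (T : measurableType d)
    (mu : {measure set T -> \bar R}) (f p : T -> R) (A : set T) (m : R) (g : T -> R)
    (Gamma Delta eps : R) :
  let P := fine (\int[mu]_(t in A) (p t)%:E)%E in
  let Q := fine (\int[mu]_(t in A) (f t / m)%:E)%E in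
  let pA t := if `[< A t >] then p t / P else 0 in
  let fA t := if `[< A t >] then f t / m / Q else 0 in
  measurable_fun setT f -> (forall t, 0 <= f t) -> 0 < m ->
  m%:E = (\int[mu]_t (f t)%:E)%E ->
  measurable_fun setT p -> (forall t, 0 <= p t) -> (\int[mu]_t (p t)%:E < +oo)%E ->
  measurable_fun setT g -> measurable A -> 0 < P ->
  (kl_dens mu pA fA <= eps%:E)%E ->
  (forall t, 0 < p t -> 0 < f t /\ `|g t - (ln (f t / (m * p t)) + Gamma)| <= Delta) ->
  [/\ 0 < Q, mu.-integrable setT (EFin \o (fun t => pA t * g t)) &
    Gamma - eps - Delta + ln Q <= \int[mu]_t (pA t * g t) + ln P <= Gamma + Delta + ln Q].
Proof.
move=> P Q pA fA mf f0 m0 mE mp p0 poo mg mA P0 kl gD.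
have mfm : measurable_fun setT (fun t => f t / m) by exact: measurable_funM.
have fm0 t : 0 <= f t / m by rewrite divr_ge0// ltW.
have fmoo : (\int[mu]_t (f t / m)%:E < +oo)%E.
  under eq_integral do rewrite mulrC EFinM.
  rewrite ge0_integralZl//.
  - by rewrite -mE ltry.
  - exact/measurable_EFinP.
  - by move=> t _; rewrite lee_fin.
  - by rewrite lee_fin invr_ge0 ltW.
have Q0 : 0 < Q.
  apply: (fine_integral_gt0_support _ _ _ _ p _ _ mA mp mfm) => //.
  by move=> t /gD[ft _]; rewrite divr_gt0.
have [mpA pA0 pA1] := normalized_density _ _ _ _ _ _ mp p0 poo mA P0.
have [mfA fA0 fA1] := normalized_density _ _ _ _ _ _ mfm fm0 fmoo mA Q0.
rewrite -/P -/pA in mpA pA0 pA1; rewrite -/Q -/fA in mfA fA0 fA1.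
have pA_gt0 t : 0 < pA t -> A t /\ 0 < p t.
  rewrite /pA; case: asboolP => [At|_]; last by rewrite ltxx.
  by rewrite pmulr_lgt0 ?invr_gt0.
have pfA t : 0 < pA t -> 0 < fA t.
  by move=> /pA_gt0[At /gD[ft _]]; rewrite /fA; case: asboolP => // _; rewrite !divr_gt0.
have [ik /andP[k0 keps]] := gibbs_inequality _ _ _ _ _ _ _ mpA mfA pA0 fA0 pA1 fA1 pfA kl.
(* On [A] the ratio [fA / pA] is [f / (m * p)] times [P / Q], so the normalizers only shift the
   constant. *)
have gDA t : 0 < pA t ->
    `|g t - (ln (fA t) - ln (pA t) + (Gamma + ln Q - ln P))| <= Delta.
  move=> /pA_gt0[At pt]; have [ft] := gD t pt.
  congr (`|g t - _| <= _); rewrite /fA /pA; case: asboolP => // _.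
  rewrite !ln_div ?posrE ?divr_gt0 ?mulr_gt0// lnM ?posrE//; ring.
have [ig] := integral_near_log_ratio _ _ _ _ _ _ _ _ _ mpA mg pA0 pA1 ik gDA.
rewrite ler_norml => /andP[g1 g2]; split => //.
by apply/andP; split; lra.
Qed.

(** * Sigma-finiteness, additivity over the classes, marginals *)

(** The Fubini-Tonelli lemmas act on bundled sigma-finite measures; this equality lets [subst]
    replace a bare measure by a bundled one. *)
Lemma sigma_finite_measureP d (T : measurableType d) (R : realType)
    (mu : {measure set T -> \bar R}) : sigma_finite setT mu ->
  exists nu : {sigma_finite_measure set T -> \bar R}, mu = nu.
Proof.
case: mu => mu [m1 m2] s.
pose H2 := isSigmaFinite.Build _ _ _ mu s.
pose H1 := isSFinite.Build _ _ _ mu (sfinite_measure_sigma_finite s).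
pose nu : {sigma_finite_measure set T -> \bar R} := HB.pack_for (SigmaFiniteMeasure.type T R) mu m1 m2 H1 H2.
by exists nu.
Qed.

(** Serves to write the normalizer of [PC_Y] as a sum over classes, so that [PC_Y] is the softmax of
    the log class masses. *)
Lemma fine_integral_bigcup_ord d (R : realType) (T : measurableType d)
    (mu : {measure set T -> \bar R}) (K : nat) (A : 'I_K -> set T) (f : T -> R) :
  (forall i, measurable (A i)) -> (forall i j, i != j -> A i `&` A j = set0) ->
  measurable_fun setT f -> (forall t, 0 <= f t) -> (\int[mu]_t (f t)%:E < +oo)%E ->
  fine (\int[mu]_(t in \bigcup_(i in [set: 'I_K]) A i) (f t)%:E)%E =
  \sum_i fine (\int[mu]_(t in A i) (f t)%:E)%E.
Proof.
move=> mA dA mf f0 foo.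
have -> : \bigcup_(i in [set: 'I_K]) A i = \big[setU/set0]_(i <- index_enum 'I_K) A i.
  by rewrite -bigcup_seq; apply: eq_bigcupl; split => i //= _; rewrite mem_index_enum.
rewrite ge0_integral_bigsetU ?index_enum_uniq//.
- rewrite -sum_fine// => i _; rewrite ge0_fin_numE; last first.
    by apply: integral_ge0 => t _; rewrite lee_fin.
  rewrite (le_lt_trans _ foo)//; apply: ge0_subset_integral => //.
  + exact/measurable_EFinP.
  + by move=> t _; rewrite lee_fin.
- apply/trivIsetP => i j _ _; exact: dA.
- by apply/measurable_EFinP; exact: measurable_funTS.
- by move=> t _; rewrite lee_fin.
Qed.

Lemma measurable_marginal d1 d2 (R : realType) (T1 : measurableType d1)
    (T2 : measurableType d2) (m2 : {sigma_finite_measure set T2 -> \bar R})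
    (f : T1 -> T2 -> R) (g : T1 -> R) :
  (forall x y, 0 <= f x y) -> measurable_fun setT (fun z : T1 * T2 => f z.1 z.2) ->
  (forall x, (g x)%:E = (\int[m2]_y (f x y)%:E)%E) -> measurable_fun setT g.
Proof.
move=> f0 mf gE; apply/measurable_EFinP.
have -> : EFin \o g = fubini_F m2 (EFin \o (fun z : T1 * T2 => f z.1 z.2)).
  by apply/funext => x /=; rewrite gE.
apply: measurable_fun_fubini_tonelli_F; first exact/measurable_EFinP.
by move=> z; rewrite lee_fin.
Qed.

(** * The excess loss of the class-mean probe *)

Theorem theorem2 (R : realType) (dX dY : measure_display)
  (X : measurableType dX) (Y : measurableType dY)
  (muX : {measure set X -> \bar R}) (muY : {measure set Y -> \bar R})
  (pXY : X -> Y -> R) (pX : X -> R) (pY : Y -> R)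
  (K : nat) (PC : X -> 'I_K -> R)
  (d : nat) (fX : X -> 'rV[R]_d) (fY : Y -> 'rV[R]_d) (tau Gamma : R)
  (Ys : 'I_K -> set Y) (eps1 eps2 Delta : R) :
  (* reference measures and the joint density with its marginals *)
  sigma_finite setT muX -> sigma_finite setT muY ->
  (forall x y, 0 <= pXY x y) ->
  measurable_fun setT (fun z : X * Y => pXY z.1 z.2) ->
  (forall x, (pX x)%:E = (\int[muY]_y (pXY x y)%:E)%E) ->
  (forall y, (pY y)%:E = (\int[muX]_x (pXY x y)%:E)%E) ->
  (\int[muX]_x (pX x)%:E)%E = 1%E ->
  (* downstream labels *)
  (forall x c, 0 <= PC x c) -> (forall x, \sum_(c < K) PC x c = 1) ->
  (forall c, measurable_fun setT (fun x => PC x c)) ->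
  (* encoders and temperature *)
  (forall i, measurable_fun setT (fun x => fX x 0 i)) ->
  (forall i, measurable_fun setT (fun y => fY y 0 i)) ->
  0 < tau ->
  (* the subsets Y_1, ..., Y_K *)
  (forall i, measurable (Ys i)) ->
  (forall i j, i != j -> Ys i `&` Ys j = set0) ->
  (forall i, 0 < PY muY pY (Ys i)) ->
  0 <= eps1 -> 0 <= eps2 -> 0 <= Delta ->
  (forall x, 0 < pX x ->
     (kl_discrete (PC x) (PC_Y muY pXY pX Ys x) <= eps1%:E)%E) ->
  (forall x c, 0 < pX x ->
     (kl_dens muY (dens_Yset muY pY (Ys c)) (dens_xYset muY pXY pX x (Ys c))
        <= eps2%:E)%E) ->
  (forall x y, 0 < pX x -> 0 < pY y ->
     0 < pXY x y /\
     `| gcrit fX fY tau x y - gstar pXY pX pY Gamma x y | <= Delta) ->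
  (ereal_inf (range (fun Wb : 'M[R]_(d, K) * 'rV[R]_K =>
                Lsup muX pX PC (linprobe fX Wb.1 Wb.2)))
     - Lsup_star muX pX PC <= (eps1 + eps2 + 2 * Delta)%:E)%E.
Proof.
move=> sX sY pXY0 mpXY pXE pYE pX1 PC0 PC1 mPC mfX mfY tau0 mYs dYs PYs0.
move=> e10 e20 D0 kl1 kl2 crit.
have [nuX EX] := sigma_finite_measureP _ _ _ _ sX; subst muX.
have [nuY EY] := sigma_finite_measureP _ _ _ _ sY; subst muY.
have mpX : measurable_fun setT pX by exact: (@measurable_marginal _ _ _ _ _ nuY pXY).
have mpY : measurable_fun setT pY.
  apply: (@measurable_marginal _ _ _ _ _ nuX (fun y x => pXY x y)) => //.
  exact: (measurableT_comp mpXY (@measurable_swap _ _ Y X)).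
(* Tonelli on the joint density carries the total mass of [pX] over to [pY]. *)
have pY1 : (\int[nuY]_y (pY y)%:E = 1)%E.
  rewrite -pX1 (eq_integral _ _ (fun x _ => pXE x)) (eq_integral _ _ (fun y _ => pYE y)).
  apply/esym; apply: (@fubini_tonelli _ _ _ _ _ nuX nuY (fun z => (pXY z.1 z.2)%:E)).
    exact/measurable_EFinP.
  by move=> z; rewrite lee_fin.
have pX0 x : 0 <= pX x by rewrite -lee_fin pXE integral_ge0// => y _; rewrite lee_fin.
have pY0 y : 0 <= pY y by rewrite -lee_fin pYE integral_ge0// => x _; rewrite lee_fin.
have mpXx x : measurable_fun setT (pXY x).
  exact: (measurableT_comp mpXY (pair1_measurable x)).
have mg x : measurable_fun setT (gcrit fX fY tau x).
  apply: measurable_funM => //.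
  have -> : (fun y => (fX x *m (fY y)^T) 0 0) = (fun y => \sum_i fX x 0 i * fY y 0 i).
    by apply/funext => y; rewrite mxE; apply: eq_bigr => i _; rewrite mxE.
  by apply: measurable_sum => i; exact: measurable_funM.
pose P c := PY nuY pY (Ys c).
pose p c := dens_Yset nuY pY (Ys c).
pose Z x c := PY_cond nuY pXY pX (Ys c) x.
have score x c : 0 < pX x ->
  [/\ 0 < Z x c, nuY.-integrable setT (EFin \o (fun y => p c y * gcrit fX fY tau x y)) &
    Gamma - eps2 - Delta + ln (Z x c) <=
    \int[nuY]_y (p c y * gcrit fX fY tau x y) + ln (P c) <= Gamma + Delta + ln (Z x c)].
  move=> px0; apply: class_score_bounds => //.
  - by rewrite pY1 ltry.
  - exact: PYs0.
  - exact: kl2.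
  - by move=> y; exact: crit.
have [w wE] := choice (fun c => integral_scaled_dot_repr _ _ _ nuY d (p c) fY).
pose W : 'M[R]_(d, K) := \matrix_(i, c) (w c i 0 / tau).
pose b : 'rV[R]_K := \row_c ln (P c).
have probeE x c : 0 < pX x ->
    linprobe fX W b x c = \int[nuY]_y (p c y * gcrit fX fY tau x y) + ln (P c).
  move=> px0; have [_ ig _] := score x c px0.
  (* The representing vector [w c] is available only at vectors with an integrable pairing; the
     score bound supplies this at [fX x], after undoing the division by [tau]. *)
  have idot : nuY.-integrable setT (EFin \o (fun y => p c y * (fX x *m (fY y)^T) 0 0)).
    have -> : (fun y => p c y * (fX x *m (fY y)^T) 0 0) =
        (fun y => tau * (p c y * gcrit fX fY tau x y)).
      apply/funext => y; rewrite /gcrit; field; exact: lt0r_neq0.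
    exact: (integrableZl _ tau ig).
  rewrite /linprobe !mxE; congr (_ + _).
  have -> : \int[nuY]_y (p c y * gcrit fX fY tau x y) =
      \int[nuY]_y (tau^-1 * (p c y * (fX x *m (fY y)^T) 0 0)).
    by apply: eq_Rintegral => y _; rewrite /gcrit; ring.
  rewrite RintegralZl// wE// mxE mulr_sumr; apply: eq_bigr => i _.
  by rewrite !mxE; ring.
pose H x := \sum_(c < K) PC x c * - ln (PC x c).
pose loss (h : X -> 'I_K -> R) x :=
  \sum_(c < K) PC x c * - ln (expR (h x c) / \sum_(i < K) expR (h x i)).
pose E := eps1 + eps2 + 2 * Delta.
have E0 : 0 <= E by rewrite /E; lra.
(* The cross-entropy against [PC_Y] costs [eps1]; the window enclosing the scores has width
   [eps2 + 2 * Delta], and averaging this constant over [PC x] leaves it unchanged. *)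
have pointwise x : 0 < pX x -> loss (linprobe fX W b) x <= H x + E.
  move=> px0.
  have Z0 c : 0 < Z x c by have [] := score x c px0.
  have PCYE c : PC_Y nuY pXY pX Ys x c = Z x c / \sum_i Z x i.
    rewrite /PC_Y; congr (_ / _); apply: fine_integral_bigcup_ord => //.
    - exact: measurable_funM.
    - by move=> y; rewrite divr_ge0.
    - under eq_integral do rewrite /condY mulrC EFinM.
      rewrite ge0_integralZl//.
      + by rewrite -pXE ltry.
      + exact/measurable_EFinP.
      + by move=> y _; rewrite lee_fin.
      + by rewrite lee_fin invr_ge0.
  have Q0 c : 0 < PC_Y nuY pXY pX Ys x c.
    rewrite PCYE divr_gt0// (bigD1 c)//= ltr_wpDr//.
    by apply: sumr_ge0 => i _; exact: ltW.
  have Hb := cross_entropy_le _ _ _ _ (PC0 x) Q0 (kl1 x px0).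
  have probe_bounds i : Gamma - eps2 - Delta + ln (Z x i) <= linprobe fX W b x i
      <= Gamma + Delta + ln (Z x i).
    by rewrite probeE//; have [] := score x i px0.
  have Sb := neg_ln_softmax_le _ _ _ _ _ Z0 probe_bounds.
  apply: (@le_trans _ _ (\sum_c PC x c * (- ln (PC_Y nuY pXY pX Ys x c) + (eps2 + 2 * Delta)))).
    apply: ler_sum => c _; apply: ler_wpM2l => //.
    by apply: le_trans (Sb c) _; rewrite PCYE; lra.
  under eq_bigr do rewrite mulrDr.
  by rewrite big_split/= -mulr_suml PC1 mul1r; move: Hb; rewrite /E -/(H x); lra.
have PC_le1 x c : PC x c <= 1.
  by rewrite -(PC1 x) (bigD1 c)//= lerDl; exact: sumr_ge0.
have H0 x : 0 <= H x.
  by apply: sumr_ge0 => c _; rewrite mulr_ge0// oppr_ge0 ln_le0.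
(* At [q = 1] the logarithm inequality gives [- p * ln p <= 1 - p <= 1]. This crude bound makes the
   expected entropy [I] finite. *)
have HK x : H x <= K%:R.
  have -> : K%:R = \sum_(c < K) (1 : R) by rewrite sumr_const card_ord.
  apply: ler_sum => c _; have := PC0 x c; rewrite le_eqVlt => /predU1P[<-|PCc].
    by rewrite mul0r.
  have := subr_le_mul_ln_div _ _ (PC0 x c) (@ltr01 R).
  by rewrite divr1 mulrN; have := PC0 x c; lra.
have mH : measurable_fun setT H.
  apply: measurable_sum => c; apply: measurable_funM => //.
  by apply: measurableT_comp => //; exact: measurableT_comp.
have mloss h : (forall c, measurable_fun setT (fun x => h x c)) ->
    measurable_fun setT (fun x => pX x * loss h x).
  move=> mh; apply: measurable_funM => //.
  have -> : loss h = fun x => \sum_(c < K) PC x c * - (h x c - ln (\sum_i expR (h x i))).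
    apply/funext => x; apply: eq_bigr => c _; rewrite ln_div ?expRK// posrE ?expR_gt0//.
    by rewrite (bigD1 c)//= ltr_wpDr ?expR_gt0// sumr_ge0// => i _; exact: expR_ge0.
  apply: measurable_sum => c; apply: measurable_funM => //.
  apply: measurableT_comp => //; apply: measurable_funB => //.
  apply: measurableT_comp => //; apply: measurable_sum => i.
  exact: measurableT_comp.
pose I := (\int[nuX]_x (pX x * H x)%:E)%E.
have mpXH : measurable_fun setT (EFin \o (fun x => pX x * H x)).
  by apply/measurable_EFinP; exact: measurable_funM.
have mcst a : measurable_fun setT (EFin \o (fun x => a * pX x)).
  by apply/measurable_EFinP; exact: measurable_funM.
have pXH0 x : (0 <= (pX x * H x)%:E)%E by rewrite lee_fin mulr_ge0.
have intcst a : 0 <= a -> (\int[nuX]_x (a * pX x)%:E = a%:E)%E.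
  move=> a0; under eq_integral do rewrite EFinM.
  rewrite ge0_integralZl// ?pX1 ?mule1//.
  - exact/measurable_EFinP.
  - by move=> x _; rewrite lee_fin.
have I_fin : I \is a fin_num.
  rewrite ge0_fin_numE ?integral_ge0//.
  apply: (@le_lt_trans _ _ (\int[nuX]_x (K%:R * pX x)%:E)%E); last by rewrite intcst ?ltry.
  apply: ge0_le_integral => //.
  - exact: mcst.
  - by move=> x _; rewrite lee_fin mulrC ler_wpM2r.
(* The entropy minorizes the loss of each [h] pointwise, so [I] is a lower bound of the set whose
   infimum is taken. *)
have star_ge : (I <= Lsup_star nuX pX PC)%E.
  apply: le_ereal_inf_tmp => _ [h /= mh <-]; apply: ge0_le_integral => //.
  - exact/measurable_EFinP/mloss.
  - move=> x _; rewrite lee_fin ler_wpM2l//; exact: entropy_le_softmax_loss.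
have mprobe c : measurable_fun setT (fun x => linprobe fX W b x c).
  have -> : (fun x => linprobe fX W b x c) = (fun x => \sum_i fX x 0 i * W i c + b 0 c).
    by apply/funext => x; rewrite /linprobe !mxE.
  apply: measurable_funD => //; apply: measurable_sum => i.
  exact: measurable_funM.
have probe_le : (Lsup nuX pX PC (linprobe fX W b) <= I + E%:E)%E.
  rewrite -(intcst E)// -ge0_integralD//; last first.
  - exact: mcst.
  - by move=> x _; rewrite lee_fin mulr_ge0.
  apply: ge0_le_integral => //.
  - move=> x _; rewrite lee_fin mulr_ge0//.
    exact: le_trans (H0 x) (entropy_le_softmax_loss _ _ _ (PC0 x) (PC1 x)).
  - exact/measurable_EFinP/mloss.
  - exact: (emeasurable_funD mpXH (mcst E)).
  - move=> x _; rewrite -EFinD lee_fin mulrC [E * _]mulrC -mulrDr mulrC.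
    (* Off the support of [pX] both integrands are 0, so the pointwise bound on the support
       suffices. *)
    have := pX0 x; rewrite le_eqVlt => /predU1P[<-|px0]; first by rewrite !mul0r.
    by rewrite ler_wpM2l//; exact: pointwise.
(* Finiteness of [I] is what permits the cancellation in the extended reals. *)
apply: (@le_trans _ _ (I + E%:E - I)%E); last by rewrite addeAC subee// add0e.
apply: leeB => //; apply: le_trans probe_le.
by apply: ereal_inf_lbound; exists (W, b).
Qed.
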